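(* Let $K$ be a compact metric space of negative type. Then $$\mathrm{Mag}((s+t)K) \le \mathrm{Mag}(sK)\,\mathrm{Mag}(tK)$$ for every $s,t>0$. In other words, $\log \mathrm{Mag}(tK)$ is subadditive in $t$.
   Context: For a finite metric space $X = \{1,\dots,n\}$ with metric $d$, the zeta matrix is the real $n\times n$ matrix $Z_X = (e^{-d(i,j)})_{i,j}$. If $Z_X$ is invertible, the magnitude is $\mathrm{Mag}(X) = \langle \mathbf{1}, Z_X^{-1}\mathbf{1}\rangle$, the sum of the entries of $Z_X^{-1}$ (where $\mathbf{1}\in\mathbb{R}^n$ has all entries $1$). For a real number $t>0$, $tX$ denotes the rescaled metric space $(X, td)$. A finite metric space $X$ is positive definite if $Z_X$ is a positive definite matrix, and is of negative type if $Z_{tX}$ is positive definite for every $t>0$. A compact metric space $K$ is positive definite (respectively of negative type) if every finite metric subspace of $K$ is positive definite (respectively of negative type). The magnitude of a compact positive definite metric space $K$ is $\mathrm{Mag}(K) = \sup\{\mathrm{Mag}(X) : X\subseteq K \text{ finite}\}$, which may equal $+\infty$; for nonempty $K$ one has $1\le \mathrm{Mag}(K)\le\infty$. Products are taken in $[0,\infty]$ in the usual way. *)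

(* Defs.v *)
From HB Require Import structures.
From mathcomp Require Import all_boot all_order all_algebra finmap.
From mathcomp Require Import all_classical all_reals all_analysis.

Set Implicit Arguments.
Unset Strict Implicit.
Unset Printing Implicit Defensive.

Import Order.TTheory GRing.Theory Num.Theory.
Local Open Scope classical_set_scope.
Local Open Scope ring_scope.

(* A metric space is handled as a carrier together with its distance function,
   so that the rescaled space (X, t d) lives on the same carrier. *)

Definition posdefmx {R : realType} {n : nat} (A : 'M[R]_n) : Prop :=
  A^T = A /\ forall v : 'cV[R]_n, v != 0 -> 0 < (v^T *m A *m v) 0 0.

Definition rescale {R : realType} {T : Type} (t : R) (d : T -> T -> R) :
  T -> T -> R := fun x y => t * d x y.

Definition zeta_mx {R : realType} {I : finType} (d : I -> I -> R) :
  'M[R]_#|I| := \matrix_(i, j) expR (- d (enum_val i) (enum_val j)).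

(* Meaningful only when [zeta_mx d] is invertible, since [invmx] is the identity
   on singular matrices. *)
Definition fin_mag {R : realType} {I : finType} (d : I -> I -> R) : R :=
  let one : 'cV[R]_#|I| := const_mx 1 in
  (one^T *m (invmx (zeta_mx d) *m one)) 0 0.

Definition fin_posdef {R : realType} {I : finType} (d : I -> I -> R) : Prop :=
  posdefmx (zeta_mx d).

Definition fin_negtype {R : realType} {I : finType} (d : I -> I -> R) : Prop :=
  forall t : R, 0 < t -> fin_posdef (rescale t d).

Definition subdist {R : realType} {T : choiceType} (d : T -> T -> R)
  (X : {fset T}) : X -> X -> R := fun x y => d (val x) (val y).

Arguments subdist {R T} d X _ _.

Definition negtype {R : realType} {T : choiceType} (d : T -> T -> R) : Prop :=
  forall X : {fset T}, fin_negtype (subdist d X).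

(* The empty subspace has magnitude 0, so it only matters for an empty carrier,
   whose magnitude is then 0 rather than -oo. *)
Definition mag {R : realType} {T : choiceType} (d : T -> T -> R) : \bar R :=
  ereal_sup [set (fin_mag (subdist d X))%:E | X in [set: {fset T}]].

(* Main.v *)
Require Import Defs.
From HB Require Import structures.
From mathcomp Require Import all_boot all_order all_algebra finmap.
From mathcomp Require Import all_classical all_reals all_analysis.
From mathcomp Require Import lra.

Set Implicit Arguments.
Unset Strict Implicit.
Unset Printing Implicit Defensive.

Import Order.TTheory GRing.Theory Num.Theory.
Local Open Scope classical_set_scope.
Local Open Scope ring_scope.

(** The zeta matrix of [(s + t) X] is the entrywise product of the zeta matrices
    [A] of [s X] and [B] of [t X], that is, the restriction of the Kronecker
    product of [A] and [B] to the diagonal copy of [X] in [X * X].  Writing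
    [A a = 1], [B b = 1] and [(A o B) v = 1], the positive form
    [W |-> tr (W^T A W B)] takes the value
    [Mag (s X) * Mag (t X) - Mag ((s + t) X)] at [W = a b^T - diag v]. *)

Lemma posdefmx_ge0 (R : realType) (n : nat) (A : 'M[R]_n) (v : 'cV[R]_n) :
  posdefmx A -> 0 <= (v^T *m A *m v) 0 0.
Proof.
case=> _ pA; have [->|/pA/ltW//] := eqVneq v 0.
by rewrite mulmx0 mxE.
Qed.

Lemma posdefmx_unit (R : realType) (n : nat) (A : 'M[R]_n) :
  posdefmx A -> A \in unitmx.
Proof.
case=> _ pA; rewrite unitmxE unitfE; apply/negP => /det0P[v v0 vA].
have vT0 : v^T != 0 by rewrite -trmx0 (inj_eq trmx_inj).
by have := pA _ vT0; rewrite trmxK vA mul0mx mxE ltxx.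
Qed.

(** For fixed [v], the block form is quadratic in the first coordinate and minimal at
    [- b^-1 * (u v)]; its minimum is the form of the Schur complement at [v]. *)
Lemma posdefmx_schur (R : realType) (n : nat) (b : R) (u : 'rV[R]_n)
    (D : 'M[R]_n) :
  posdefmx (block_mx b%:M u u^T D) -> 0 < b /\ posdefmx (D - b^-1 *: (u^T *m u)).
Proof.
case=> sA pA.
have b0 : 0 < b.
  have := pA (col_mx 1%:M 0); rewrite tr_col_mx trmx1 trmx0 mul_row_block.
  rewrite mul_row_col !mul0mx !mulmx0 !addr0 mul1mx mulmx1 mxE eqxx => -> //.
  by rewrite col_mx_eq0 negb_and oner_eq0.
split=> //; split.
  move: sA; rewrite tr_block_mx => /eq_block_mx[_ _ _ sD].
  by rewrite linearB /= linearZ /= trmx_mul trmxK sD.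
move=> v v0; set y := u *m v.
set w := col_mx (- b^-1 *: y) v.
have w0 : w != 0 by rewrite col_mx_eq0 negb_and v0 orbT.
suff -> : v^T *m (D - b^-1 *: (u^T *m u)) *m v =
          w^T *m block_mx b%:M u u^T D *m w by exact: pA.
rewrite /w tr_col_mx mul_row_block mul_row_col mulmxBr !mulmxDl mulNmx.
rewrite -scalemxAr -scalemxAl !linearZ /= -!scalemxAl mul_mx_scalar.
rewrite -!mulmxA -/y !mulmxA -trmx_mul -/y -?mulmxA -?scalemxAr -?scalemxAl.
rewrite (scalerA _ b) mulNr mulVf ?gt_eqF // scaleN1r !scaleNr !scalerN opprK.
by rewrite subrr add0r addrC.
Qed.

(** Cholesky factorization, by induction on the size: split off the first row and column and factor
    the Schur complement. *)
Lemma posdefmx_factor (R : realType) (n : nat) (A : 'M[R]_n) :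
  posdefmx A -> exists L : 'M[R]_n, A = L^T *m L.
Proof.
elim: n A => [|n IHn] A pA; first by exists 0; apply/matrixP => -[].
have sA := pA.1; move: pA; rewrite -[A](@submxK _ 1 n 1 n).
have -> : @dlsubmx _ 1 n 1 n A = (@ursubmx _ 1 n 1 n A)^T.
  by rewrite trmx_ursub sA.
rewrite [X in block_mx X](mx11_scalar).
set b := (X in X%:M); set u := ursubmx _; set D := drsubmx _.
move=> /posdefmx_schur[b0 /IHn[L SL]].
(* The top row of [M] contributes [b], [u], [u^T] and [b^-1 *: (u^T *m u)] to [M^T *m M]; the last
   is what the Schur complement subtracted from [D]. *)
pose M := block_mx (Num.sqrt b)%:M ((Num.sqrt b)^-1 *: u) 0 L.
suff AM : block_mx b%:M u u^T D = M^T *m M by exists M.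
rewrite /M tr_block_mx mulmx_block !trmx0 !mul0mx mulmx0 !addr0 tr_scalar_mx.
rewrite -scalar_mxM -expr2 sqr_sqrtr ?ltW //.
rewrite !linearZ /= -!scalemxAl mul_scalar_mx mul_mx_scalar.
rewrite !scalerA mulVf ?sqrtr_eq0 -?ltNge // !scale1r -SL.
rewrite -expr2 exprVn sqr_sqrtr ?ltW //.
by rewrite (addrC (b^-1 *: _)) subrK.
Qed.

(** With [B = L^T *m L], cyclicity moves [L] to the front, and each diagonal entry becomes the form
    of [A] at a column of [W *m L^T]. *)
Lemma mxtrace_posdef_ge0 (R : realType) (m n : nat) (A : 'M[R]_m)
    (B : 'M[R]_n) (W : 'M[R]_(m, n)) :
  posdefmx A -> posdefmx B -> 0 <= \tr (W^T *m A *m W *m B).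
Proof.
move=> pA /posdefmx_factor[L ->].
rewrite mulmxA mxtrace_mulC !mulmxA; apply: sumr_ge0 => i _.
have := posdefmx_ge0 (col i (W *m L^T)) pA; congr (_ <= _).
rewrite tr_col trmx_mul trmxK -row_mul -[L *m _ *m A *m W *m _]mulmxA !mxE.
by apply: eq_bigr => k _; rewrite !mxE.
Qed.

Lemma hadamard_weight_le (R : realType) (n : nat) (A B : 'M[R]_n)
    (a b v : 'cV[R]_n) :
  posdefmx A -> posdefmx B ->
  A *m a = const_mx 1 -> B *m b = const_mx 1 ->
  map2_mx *%R A B *m v = const_mx 1 ->
  \sum_i v i 0 <= (\sum_i a i 0) * (\sum_i b i 0).
Proof.
move=> pA pB Aa Bb ABv.
have sA := pA.1; have sB := pB.1.
set V := a *m b^T; set D := diag_mx v^T.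
(* [A V B = (A a) (B b)^T] is the all-ones matrix, so a trace ending in [A V B] is a sum of
   entries. *)
have AVB : A *m V *m B = const_mx 1.
  rewrite mulmxA Aa -mulmxA -[B in b^T *m B]sB -trmx_mul Bb.
  by apply/matrixP => i j; rewrite !mxE big_ord1 !mxE mulr1.
have VE i j : V i j = a i 0 * b j 0 by rewrite mxE big_ord1 mxE.
move: V AVB VE => V AVB VE.
(* Since [B] is symmetric, the [i]-th diagonal entry is [v i 0] times the [i]-th entry of
   [(A o B) v], which is 1. *)
have trDD : \tr (D^T *m A *m D *m B) = \sum_i v i 0.
  apply: eq_bigr => i _; rewrite tr_diag_mx -!mulmxA mul_diag_mx !mxE.
  rewrite -[RHS]mulr1; congr (_ * _).
  move/matrixP: ABv => /(_ i 0); rewrite !mxE => <-; apply: eq_bigr => k _.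
  rewrite mul_diag_mx !mxE -[B in LHS]sB mxE.
  by rewrite mulrCA mulrC.
have trDV : \tr (D^T *m A *m V *m B) = \sum_i v i 0.
  rewrite -!mulmxA (mulmxA A) AVB tr_diag_mx.
  by apply: eq_bigr => i _; rewrite mul_diag_mx !mxE mulr1.
have trVD : \tr (V^T *m A *m D *m B) = \sum_i v i 0.
  by rewrite -trDV -mxtrace_tr !trmx_mul !trmxK sA sB mxtrace_mulC !mulmxA.
have trVV : \tr (V^T *m A *m V *m B) = (\sum_i a i 0) * (\sum_i b i 0).
  rewrite -!mulmxA (mulmxA A) AVB mulrC mulr_suml.
  apply: eq_bigr => i _; rewrite mxE mulr_sumr; apply: eq_bigr => j _.
  by rewrite !mxE mulr1 VE mulrC.
(* The two cross terms and the [D] term all equal the sum of [v], so the expansion leaves the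
   product of the sums minus one copy of it. *)
have := mxtrace_posdef_ge0 (V - D) pA pB.
rewrite !(linearB, mulmxBl) /= !(linearB, mulmxBl) /= trDD trDV trVD trVV.
lra.
Qed.

Lemma zeta_weightK (R : realType) (I : finType) (d : I -> I -> R) :
  fin_posdef d ->
  zeta_mx d *m (invmx (zeta_mx d) *m const_mx 1) = const_mx 1 :> 'cV_#|I|.
Proof. by move=> /posdefmx_unit uZ; rewrite mulKVmx. Qed.

Lemma fin_magE (R : realType) (I : finType) (d : I -> I -> R) :
  fin_mag d =
  \sum_i (invmx (zeta_mx d) *m (const_mx 1 : 'cV[R]_#|I|)) i 0.
Proof.
by rewrite /fin_mag mxE; apply: eq_bigr => i _; rewrite !mxE mul1r.
Qed.

(** For [w = Z^-1 1], the form [w^T Z w] equals [w^T 1], the magnitude. *)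
Lemma fin_mag_ge0 (R : realType) (I : finType) (d : I -> I -> R) :
  fin_posdef d -> 0 <= fin_mag d.
Proof.
move=> pd; have := posdefmx_ge0 (invmx (zeta_mx d) *m const_mx 1) pd.
rewrite -mulmxA zeta_weightK // fin_magE mxE.
by congr (_ <= _); apply: eq_bigr => i _; rewrite !mxE mulr1.
Qed.

Lemma zeta_mx_rescaleD (R : realType) (I : finType) (d : I -> I -> R) (s t : R) :
  zeta_mx (rescale (s + t) d) =
  map2_mx *%R (zeta_mx (rescale s d)) (zeta_mx (rescale t d)).
Proof. by apply/matrixP => i j; rewrite !mxE -expRD -opprD -mulrDl. Qed.

Lemma fin_mag_rescaleD (R : realType) (I : finType) (d : I -> I -> R) (s t : R) :
  fin_negtype d -> 0 < s -> 0 < t ->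
  fin_mag (rescale (s + t) d) <=
  fin_mag (rescale s d) * fin_mag (rescale t d).
Proof.
move=> nd s0 t0; rewrite !fin_magE.
apply: (hadamard_weight_le (nd s s0) (nd t t0)).
- exact/zeta_weightK/nd.
- exact/zeta_weightK/nd.
- by rewrite -zeta_mx_rescaleD; apply/zeta_weightK/nd/addr_gt0.
Qed.

Lemma le_fin_mag_mag (R : realType) (T : choiceType) (d : T -> T -> R)
    (X : {fset T}) :
  ((fin_mag (subdist d X))%:E <= mag d)%E.
Proof. by apply: ereal_sup_ubound; exists X. Qed.

Lemma mag_rescale_ge0 (R : realType) (T : choiceType) (d : T -> T -> R) (t : R) :
  negtype d -> 0 < t -> (0 <= mag (rescale t d))%E.
Proof.
(* The empty subspace is a witness available for every carrier. *)
move=> nd t0; apply: le_trans (le_fin_mag_mag (rescale t d) fset0).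
by rewrite lee_fin; apply: fin_mag_ge0; exact: (nd fset0 t t0).
Qed.

(** The finite inequality passes to suprema one subspace at a time; nonnegative finite magnitudes
    let the two bounds be multiplied in the extended reals. *)
Lemma mag_rescaleD (R : realType) (T : choiceType) (d : T -> T -> R) (s t : R) :
  negtype d -> 0 < s -> 0 < t ->
  (mag (rescale (s + t) d) <= mag (rescale s d) * mag (rescale t d))%E.
Proof.
move=> nd s0 t0; apply: ge_ereal_sup => _ [X _ <-].
apply: (@le_trans _ _ ((fin_mag (subdist (rescale s d) X))%:E *
                       (fin_mag (subdist (rescale t d) X))%:E)%E).
  by rewrite -EFinM lee_fin; exact: (fin_mag_rescaleD (nd X) s0 t0).
apply: lee_pmul; rewrite ?le_fin_mag_mag // lee_fin; apply: fin_mag_ge0.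
- exact: (nd X s s0).
- exact: (nd X t t0).
Qed.

Lemma lne_le_addM (R : realType) (x y z : \bar R) :
  (0 <= y -> 0 <= z -> x <= y * z -> lne x <= lne y + lne z)%E.
Proof.
move=> y0 z0 xyz.
(* [lne] is [-oo] at nonpositive arguments; otherwise [y * z] is positive, which excludes zero
   factors, and the product law for [lne] applies. *)
have [x0|x0] := leP x 0%E; first by rewrite le0_lneNy ?leNye.
have yz0 := lt_le_trans x0 xyz.
have {}y0 : (0 < y)%E.
  by rewrite lt0e y0 andbT; apply: contraTneq yz0 => ->; rewrite mul0e ltxx.
have {}z0 : (0 < z)%E.
  by rewrite lt0e z0 andbT; apply: contraTneq yz0 => ->; rewrite mule0 ltxx.
rewrite -lneM ?in_itv /= ?y0 ?z0 ?leey //.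
by rewrite lee_lne // in_itv /= leey ?andbT ltW.
Qed.

Theorem theorem1p2 (R : realType) (K : metricType R)
    (cK : compact [set: K]) (nK : negtype (@mdist R K))
    (s t : R) (s0 : 0 < s) (t0 : 0 < t) :
  (mag (rescale (s + t) (@mdist R K))
     <= mag (rescale s (@mdist R K)) * mag (rescale t (@mdist R K)))%E /\
  (lne (mag (rescale (s + t) (@mdist R K)))
     <= lne (mag (rescale s (@mdist R K))) + lne (mag (rescale t (@mdist R K))))%E.
Proof.
have le_mag := mag_rescaleD nK s0 t0.
by split=> //; apply: lne_le_addM => //; exact: mag_rescale_ge0.
Qed.
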